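(* Let $p,q,m$ be integers with $\gcd(p,q)=1$, and let \[ G(p,q,m)=\langle a,b,t \mid t^{-1}at=aba^{m-1},\ t^{-1}bt=a^{-1},\ t^p[a,b]^q=1\rangle , \] where $[a,b]=aba^{-1}b^{-1}$. If $p\ge 2q>1$, then $G(p,q,m)$ contains a generalized torsion element.
   Context: A generalized torsion element of a group $G$ is a non-trivial element $g\in G$ such that some non-empty finite product of conjugates of $g$ equals the identity, i.e. there are $k\ge 1$ and $x_1,\dots,x_k\in G$ with $(x_1^{-1}gx_1)(x_2^{-1}gx_2)\cdots(x_k^{-1}gx_k)=1$. *)

(* Defs.v *)
From HB Require Import structures.
From mathcomp Require Import all_boot all_order all_algebra.
From mathcomp Require Import monoid.
From mathcomp Require Import boolp.

Set Implicit Arguments.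
Unset Strict Implicit.
Unset Printing Implicit Defensive.

Import Order.TTheory GRing.Theory Num.Theory.

Local Open Scope quotient_scope.
Local Open Scope group_scope.

(* MathComp only provides powers with exponents in nat. *)
Definition expgz (G : baseGroupType) (g : G) (z : int) : G :=
  match z with Posz n => g ^+ n | Negz n => g ^- n.+1 end.

(* [g ^ x] is [x^-1 * g * x]; the sequence [xs] is x_1, ..., x_k, k >= 1. *)
Definition generalized_torsion (G : groupType) (g : G) : Prop :=
  g <> 1 /\
  exists xs : seq G, (0 < size xs)%N /\ \prod_(x <- xs) (g ^ x) = 1.

(* Unreduced words in the letters x (encoded (x, false)) and x^-1 (encoded
   (x, true)). The operations below make words a monoid with formal inverses;
   it becomes a group only after taking the quotient. *)
Definition word (X : Type) : Type := seq (X * bool).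

HB.instance Definition _ (X : Type) := gen_eqMixin (word X).
HB.instance Definition _ (X : Type) := gen_choiceMixin (word X).

Definition letter_inv (X : Type) (l : X * bool) : X * bool := (l.1, ~~ l.2).

Definition word_inv (X : Type) (u : word X) : word X :=
  rev (map (@letter_inv X) u).

HB.instance Definition _ (X : Type) := hasMul.Build (word X) (@cat (X * bool)).
HB.instance Definition _ (X : Type) := hasOne.Build (word X) [::].
HB.instance Definition _ (X : Type) := hasInv.Build (word X) (@word_inv X).

Definition gen (X : Type) (x : X) : word X := [:: (x, false)].

Section Presentation.

Variables (X : Type) (R : seq (word X * word X)).

(* The congruence generated by free cancellation and by the relations
   r.1 = r.2, for r in R. *)
Inductive pres_eq : word X -> word X -> Prop :=
| pres_refl u : pres_eq u u
| pres_sym u v : pres_eq u v -> pres_eq v u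
| pres_trans u v w : pres_eq u v -> pres_eq v w -> pres_eq u w
| pres_mul u u' v v' : pres_eq u u' -> pres_eq v v' -> pres_eq (u * v) (u' * v')
| pres_cancel l : pres_eq [:: l; letter_inv l] 1
| pres_rel r : r \in R -> pres_eq r.1 r.2.

Definition pres_eqb (u v : word X) : bool := `[< pres_eq u v >].

Lemma pres_eqb_refl : reflexive pres_eqb.
Proof. by move=> u; apply/asboolP; apply: pres_refl. Qed.

Lemma pres_eqb_sym : symmetric pres_eqb.
Proof. by move=> u v; apply/asboolP/asboolP; apply: pres_sym. Qed.

Lemma pres_eqb_trans : transitive pres_eqb.
Proof.
move=> v u w /asboolP uv /asboolP vw; apply/asboolP.
exact: pres_trans uv vw.
Qed.

Canonical pres_equiv_rel :=
  EquivRel pres_eqb pres_eqb_refl pres_eqb_sym pres_eqb_trans.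

Definition presented : Type := {eq_quot pres_equiv_rel}.

HB.instance Definition _ := Choice.on presented.
HB.instance Definition _ := EqQuotient.on presented.

Definition pres_pi (u : word X) : presented := \pi_presented u.

Lemma pres_piP u v : pres_pi u = pres_pi v <-> pres_eq u v.
Proof.
split; first by move=> /(@eqmodP _ pres_equiv_rel) /asboolP.
by move=> uv; apply/(@eqmodP _ pres_equiv_rel)/asboolP.
Qed.

Lemma pres_reprK c : pres_pi (repr c) = c.
Proof. exact: reprK. Qed.

Lemma pres_mulV (u : word X) : pres_eq (u * u^-1) 1.
Proof.
elim: u => [|l u IHu]; first exact: pres_refl.
have -> : mul (l :: u : word X) (inv (l :: u : word X)) =
    mul ([:: l] : word X)
        (mul (mul (u : word X) (inv (u : word X)))
             ([:: letter_inv l] : word X)).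
  by rewrite /mul /inv /= /word_inv /= rev_cons -cats1 -catA.
apply: pres_trans (pres_cancel l).
apply: (@pres_mul [:: l] [:: l] _ [:: letter_inv l]); first exact: pres_refl.
by apply: (@pres_mul _ 1 [:: letter_inv l] [:: letter_inv l] IHu); apply: pres_refl.
Qed.

Lemma word_invK : involutive (@word_inv X).
Proof.
move=> u; rewrite /word_inv map_rev revK; apply: mapK.
by case=> x b; rewrite /letter_inv /= negbK.
Qed.

Lemma pres_Vmul (u : word X) : pres_eq (u^-1 * u) 1.
Proof.
by have := pres_mulV (word_inv u); rewrite [inv (word_inv u)]word_invK.
Qed.

Lemma pres_inv (u v : word X) : pres_eq u v -> pres_eq u^-1 v^-1.
Proof.
move=> uv; apply: (@pres_trans _ (u^-1 * (v * v^-1))).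
  have -> : u^-1 = u^-1 * (1 : word X) by rewrite /mul /= cats0.
  apply: pres_mul; last exact/pres_sym/pres_mulV.
  by rewrite /mul /= cats0; apply: pres_refl.
have -> : u^-1 * (v * v^-1) = (u^-1 * v) * v^-1 by rewrite /mul /= catA.
apply: (@pres_mul _ 1 _ v^-1); last exact: pres_refl.
apply: pres_trans (pres_Vmul u).
by apply: pres_mul; [apply: pres_refl | apply: pres_sym].
Qed.

Definition pres_op (c d : presented) : presented := pres_pi (repr c * repr d).
Definition pres_opV (c : presented) : presented := pres_pi (repr c)^-1.

Lemma pres_piM u v : pres_op (pres_pi u) (pres_pi v) = pres_pi (u * v).
Proof. by apply/pres_piP; apply: pres_mul; apply/pres_piP/pres_reprK. Qed.

Lemma pres_piV u : pres_opV (pres_pi u) = pres_pi u^-1.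
Proof. by apply/pres_piP/pres_inv/pres_piP/pres_reprK. Qed.

Lemma pres_mulA : associative pres_op.
Proof.
move=> c d e; rewrite -[c]pres_reprK -[d]pres_reprK -[e]pres_reprK !pres_piM.
by rewrite /mul /= catA.
Qed.

Lemma pres_mul1 : left_id (pres_pi 1) pres_op.
Proof. by move=> c; rewrite -[c]pres_reprK pres_piM. Qed.

Lemma pres_mulr1 : right_id (pres_pi 1) pres_op.
Proof. by move=> c; rewrite -[c]pres_reprK pres_piM /mul /= cats0. Qed.

Lemma pres_mulVl : left_inverse (pres_pi 1) pres_opV pres_op.
Proof.
move=> c; rewrite -[c]pres_reprK pres_piV pres_piM.
exact/pres_piP/pres_Vmul.
Qed.

Lemma pres_mulVr : right_inverse (pres_pi 1) pres_opV pres_op.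
Proof.
move=> c; rewrite -[c]pres_reprK pres_piV pres_piM.
exact/pres_piP/pres_mulV.
Qed.

HB.instance Definition _ :=
  isGroup.Build presented pres_mulA pres_mul1 pres_mulr1 pres_mulVl pres_mulVr.

End Presentation.

Section UniversalProperty.

Variables (X : Type) (R : seq (word X * word X)) (H : groupType) (f : X -> H).

Definition word_eval (u : word X) : H :=
  \prod_(l <- u) (if l.2 then (f l.1)^-1 else f l.1).

Lemma word_evalM : {morph word_eval : u v / u * v}.
Proof. by move=> u v; apply: big_cat. Qed.

Lemma pres_lift :
  (forall r, r \in R -> word_eval r.1 = word_eval r.2) ->
  exists phi : presented R -> H,
    {morph phi : x y / x * y} /\ forall u, phi (pres_pi R u) = word_eval u.
Proof.
move=> fR.
have ev_eq u v : pres_eq R u v -> word_eval u = word_eval v.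
  elim=> // {u v} [u v w _ -> _ -> // | u u' v v' _ uu' _ vv' | [x b]].
    by rewrite !word_evalM uu' vv'.
  rewrite /word_eval big_cons big_seq1 big_nil /=.
  by case: b => /=; rewrite ?mulVg ?mulgV.
have phiE u : word_eval (repr (pres_pi R u)) = word_eval u.
  by apply/ev_eq/pres_piP/pres_reprK.
exists (fun c => word_eval (repr c)); split=> // c d.
rewrite -[c in LHS]pres_reprK -[d in LHS]pres_reprK.
have -> : pres_pi R (repr c) * pres_pi R (repr d) =
    pres_pi R (repr c * repr d) by exact: pres_piM.
by rewrite phiE word_evalM.
Qed.

End UniversalProperty.

Inductive gen_abt : Set := gen_a | gen_b | gen_t.

Definition Gpqm_relations (p q m : int) : seq (word gen_abt * word gen_abt) :=
  let a := gen gen_a in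
  let b := gen gen_b in
  let t := gen gen_t in
  [:: (t^-1 * a * t, a * b * expgz a (m - 1)%R);
      (t^-1 * b * t, a^-1);
      (expgz t p * expgz (a * b * a^-1 * b^-1) q, 1)].

Definition Gpqm (p q m : int) : groupType := presented (Gpqm_relations p q m).

(* Main.v *)
Require Import Defs.
From mathcomp Require Import all_boot all_order all_algebra.
From mathcomp Require Import monoid.

Import Order.TTheory GRing.Theory Num.Theory.

Local Open Scope ring_scope.

(** The element [t] itself is a generalized torsion element.

    It is nontrivial: since [p >= 2 * q >= 2], sending [a] and [b] to the identity
    and [t] to a generator maps the group onto a nontrivial cyclic group of order
    [p] ([t_neq1]).

    The relation [t^-1 b t = a^-1] writes both [a b] and [a^-1 b^-1] as [t^-1]
    times a conjugate of [t]: [a b = t^-1 (b^-1 t b)] and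
    [a^-1 b^-1 = t^-1 (b t b^-1)].  The factor [t^2] compensates
    the two [t^-1]: writing [c] for the commutator [a b a^-1 b^-1],
      [t^2 c = (t (b^-1 t b) t^-1) (b t b^-1)],
    a product of two conjugates of [t] ([square_mul_commutator]).

    Moreover [t] commutes with [c] ([commute_boundary]): without its last relation
    the presentation is that of a once-punctured torus bundle, and the two elements
    generate the fundamental group of its boundary torus.  The filling relation
    therefore reads
      [1 = t^p c^q = t^(p - 2 q) (t^2 c)^q],
    and, as [p >= 2 q], the right-hand side is a product of
    [(p - 2 q) + 2 q = p] conjugates of [t] ([filling_generalized_torsion]). *)

Section GroupIdentities.

Local Open Scope group_scope.

Variables (G : groupType) (a b t : G).

Lemma square_mul_commutator : t^-1 * b * t = a^-1 ->
  t ^+ 2 * (a * b * a^-1 * b^-1) = t ^ (b * t^-1) * t ^ b^-1.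
Proof.
move=> tb; have -> : a = t^-1 * b^-1 * t by rewrite -[a]invgK -tb !gnorm.
by rewrite expg2 !conjgE !gnorm.
Qed.

(** Conjugation by [t] carries [(a, b)] to [(a b c, a^-1)]; in the commutator
    [(a b c) a^-1 (c^-1 b^-1 a^-1) a] of that pair, [c] slides past [a^-1] and
    cancels.  In the presentation [c] is a power of [a]. *)
Lemma commute_boundary c : commute a c ->
  t^-1 * a * t = a * b * c -> t^-1 * b * t = a^-1 ->
  commute t (a * b * a^-1 * b^-1).
Proof.
move=> ac ta tb; apply/commute_sym/commgP/conjg_fixP.
have ea : a ^ t = a * b * c by rewrite -ta conjgE mulgA.
have eb : b ^ t = a^-1 by rewrite -tb conjgE mulgA.
rewrite !conjMg !conjVg ea eb !gnorm.
(* [gnorm] has flattened the product, so [c * a^-1 * c^-1] is regrouped. *)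
have -> : a * b * c * a^-1 / c = a * b * (c * a^-1 * c^-1) by rewrite !gnorm.
by rewrite -(commute_sym (commuteV (commute_sym ac))) !gnorm.
Qed.

(** The exponent [2 * q + r] is [p], so that [r >= 0] encodes [p >= 2 * q]. *)
Lemma filling_generalized_torsion q r :
    t <> 1 -> (0 < q)%N ->
    t^-1 * b * t = a^-1 -> commute t (a * b * a^-1 * b^-1) ->
    t ^+ (2 * q + r) * (a * b * a^-1 * b^-1) ^+ q = 1 ->
  generalized_torsion t.
Proof.
move=> t1 q0 tb tc rel; split=> //.
exists (nseq r 1 ++ flatten (nseq q [:: b * t^-1; b^-1])); split.
  by case: q q0 {rel} => // q _; rewrite size_cat /= addnS.
rewrite big_cat big_flatten /= !big_nseq !big_cons big_nil mulg1 conjg1.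
have t2c : commute (t ^+ 2) (a * b * a^-1 * b^-1).
  exact/commute_sym/commuteX/commute_sym.
rewrite !iter_mulg_1 -(square_mul_commutator tb) -[RHS]rel (expgMn _ t2c).
by rewrite -expgnA addnC (expgnDr _ r) mulgA.
Qed.

Lemma commute_expgz (x : G) z : commute x (expgz x z).
Proof.
by case: z => n /=; [|apply: commuteV]; apply: commuteX; apply: commute_refl.
Qed.

End GroupIdentities.

Section Presentations.

Local Open Scope group_scope.

Lemma expgz_morph (B : baseGroupType) (H : groupType) (f : B -> H) :
    f 1 = 1 -> {morph f : x y / x * y} -> {morph f : x / x^-1} ->
  forall x z, f (expgz x z) = expgz (f x) z.
Proof.
move=> f1 fM fV x.
have fX n : f (x ^+ n) = f x ^+ n.
  case: n => [|n]; first exact: f1.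
  by elim: n => [|n IH]; [rewrite !expg1 | rewrite expgSS fM IH -expgS].
by case=> n /=; rewrite ?fV fX.
Qed.

Lemma word_eval1 X (H : groupType) (f : X -> H) : word_eval f 1 = 1.
Proof. exact: big_nil. Qed.

Lemma word_eval_gen X (H : groupType) (f : X -> H) x :
  word_eval f (gen x) = f x.
Proof. exact: big_seq1. Qed.

Lemma word_evalV X (H : groupType) (f : X -> H) :
  {morph word_eval f : u / u^-1}.
Proof.
elim=> [|[x s] u IH]; first by rewrite /word_eval /= !big_nil invg1.
have -> : (((x, s) :: u : word X)^-1 = (u : word X)^-1 * [:: (x, ~~ s)] :> word X).
  by rewrite /mul /inv /= /word_inv /= rev_cons -cats1.
rewrite word_evalM IH /word_eval big_seq1 big_cons invgM /=.
by case: s => //=; rewrite invgK.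
Qed.

Lemma word_eval_expgz X (H : groupType) (f : X -> H) u z :
  word_eval f (expgz u z) = expgz (word_eval f u) z.
Proof.
apply: expgz_morph.
- exact: word_eval1.
- exact: word_evalM.
- exact: word_evalV.
Qed.

Variables (X : Type) (R : seq (word X * word X)).

Lemma pres_pi_morphM : {morph pres_pi R : u v / u * v}.
Proof. by move=> u v; rewrite -pres_piM. Qed.

Lemma pres_pi_morphV : {morph pres_pi R : u / u^-1}.
Proof. by move=> u; rewrite -pres_piV. Qed.

Lemma pres_pi_expgz u z : pres_pi R (expgz u z) = expgz (pres_pi R u) z.
Proof. exact: (expgz_morph _ _ _ _ pres_pi_morphM pres_pi_morphV). Qed.

Lemma pres_pi_rel u v : (u, v) \in R -> pres_pi R u = pres_pi R v.
Proof. by move=> uvR; apply/pres_piP; apply: (pres_rel uvR). Qed.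

(** Nontriviality in a presented group is certified by any assignment of the
    generators that satisfies the relations. *)
Lemma pres_pi_neq1 (H : groupType) (f : X -> H) u :
    (forall r, r \in R -> word_eval f r.1 = word_eval f r.2) ->
  word_eval f u <> 1 -> pres_pi R u <> 1.
Proof.
move=> fR fu u1; have [phi [_ phiE]] := pres_lift fR.
by apply: fu; rewrite -phiE u1 -(word_eval1 _ _ f) -phiE.
Qed.

End Presentations.

Section Fillings.

Local Open Scope group_scope.

(** The exponent sum of [t] modulo [p + 2]; the group law on ['I_p.+2] is addition,
    so its identity [1] is the residue 0 and [Zp1] is the residue 1. *)
Definition t_count p (x : gen_abt) : 'I_p.+2 :=
  if x is gen_t then Zp1 else 1.

Lemma t_neq1 (p : nat) q m :
  pres_pi (Gpqm_relations p.+2 q m) (gen gen_t) <> 1.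
Proof.
apply: (@pres_pi_neq1 _ _ _ (t_count p)); last by rewrite word_eval_gen.
have one z : expgz (1 : 'I_p.+2) z = 1.
  by case: z => n /=; rewrite expg1n ?invg1.
have evE := (word_evalM (t_count p), word_eval_expgz _ _ (t_count p),
  word_evalV _ _ (t_count p), word_eval_gen _ _ (t_count p),
  word_eval1 _ _ (t_count p)).
move=> r; rewrite !inE => /or3P[] /eqP ->; cbn [fst snd]; rewrite !evE.
- by rewrite one !gsimp.
- by rewrite !gsimp.
- rewrite !gsimp one mulg1 [LHS]Zp_expg.
  by apply: val_inj; rewrite /= mul1n modnn.
Qed.

Lemma Gpqm_rels p q m :
  let a := pres_pi (Gpqm_relations p q m) (gen gen_a) in
  let b := pres_pi (Gpqm_relations p q m) (gen gen_b) in
  let t := pres_pi (Gpqm_relations p q m) (gen gen_t) in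
  [/\ t^-1 * a * t = a * b * expgz a (m - 1)%R,
      t^-1 * b * t = a^-1 &
      expgz t p * expgz (a * b * a^-1 * b^-1) q = 1].
Proof.
set R := Gpqm_relations p q m => a b t.
have rel i : (i < 3)%N ->
    pres_pi R (nth (1, 1) R i).1 = pres_pi R (nth (1, 1) R i).2.
  by move=> i3; apply: pres_pi_rel; rewrite -surjective_pairing mem_nth.
split; [move: (rel 0%N isT) | move: (rel 1%N isT) | move: (rel 2%N isT)];
  by cbn [nth fst snd R Gpqm_relations];
     rewrite !(pres_pi_morphM, pres_pi_morphV, pres_pi_expgz).
Qed.

End Fillings.

Theorem theorem5p6 (p q m : int) (hcop : gcdz p q = 1)
    (hpq : p >= 2 * q) (hq : 2 * q > 1) :
  exists g : Gpqm p q m, generalized_torsion g.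
Proof.
(* A negative [q] or [p] contradicts the bounds by computation. *)
case: q hcop hpq hq => [q _ | //]; case: p => [p | //].
rewrite -PoszM lez_nat ltz_nat => hpq hq.
(* In [int], [2] is the ring numeral [1 + 1], hence the restatement over [nat]. *)
have {hpq} hpq : (2 * q <= p)%N by [].
have q0 : (0 < q)%N by case: q hq {hpq}.
exists (pres_pi _ (gen gen_t)).
have [ta tb fill] := Gpqm_rels p q m.
have p2 : (1 < p)%N by apply: leq_trans hpq.
apply: (@filling_generalized_torsion _ _ _ _ q (p - 2 * q)%N _ q0 tb).
- by case: p p2 {hpq ta tb fill} => [|[|p]] // _; apply: t_neq1.
- exact: commute_boundary (commute_expgz _ _ _) ta tb.
- by rewrite subnKC.
Qed.
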